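(* There exist infinitely many pairwise non-isomorphic detour-saturated graphs of girth $6$, and there exists a detour-saturated graph of girth $7$ and order $30$.
   Context: All graphs are finite and simple. A detour of a graph $G$ is a longest path in $G$. The detour order $\tau(G)$ of $G$ is the number of vertices in a detour of $G$. A graph $G$ is detour-saturated if $\tau(G+e)>\tau(G)$ for every edge $e$ of the complement $\bar{G}$. The girth of a graph is the length of a shortest cycle in it. *)

(* Defs.v *)
From HB Require Import structures.
From mathcomp Require Import all_boot.

Set Implicit Arguments.
Unset Strict Implicit.
Unset Printing Implicit Defensive.

Record sgraph := SGraph {
  vertex :> finType;
  adj : rel vertex;
  adj_sym : symmetric adj;
  adj_irrefl : irreflexive adj
}.

Definition gisom (G H : sgraph) : Prop :=
  exists f : G -> H, bijective f /\ forall x y : G, adj (f x) (f y) = adj x y.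

(* The guard [u != v] keeps the relation irreflexive when [x = y]. *)
Definition add_edge_adj (G : sgraph) (x y : G) : rel G :=
  fun u v => adj u v || (u != v) && ([set u; v] == [set x; y]).

Lemma add_edge_sym (G : sgraph) (x y : G) : symmetric (add_edge_adj x y).
Proof. by move=> u v; rewrite /add_edge_adj adj_sym eq_sym setUC. Qed.

Lemma add_edge_irrefl (G : sgraph) (x y : G) : irreflexive (add_edge_adj x y).
Proof. by move=> u; rewrite /add_edge_adj adj_irrefl eqxx. Qed.

Definition add_edge (G : sgraph) (x y : G) : sgraph :=
  SGraph (add_edge_sym x y) (add_edge_irrefl x y).

Definition gpath (G : sgraph) (s : seq G) : bool := uniq s && sorted (@adj G) s.

Definition detour_order (G : sgraph) : nat :=
  \max_(n < #|G|.+1 | [exists t : n.-tuple G, gpath t]) n.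

Definition detour_saturated (G : sgraph) : Prop :=
  forall x y : G, x != y -> ~~ adj x y ->
    detour_order G < detour_order (add_edge x y).

(* [ucycle] alone accepts sequences of length at most 2, such as a single edge
   traversed back and forth. *)
Definition gcycle (G : sgraph) (c : seq G) : Prop :=
  2 < size c /\ ucycle (@adj G) c.

(* Relational, since an acyclic graph has no girth. *)
Definition has_girth (G : sgraph) (g : nat) : Prop :=
  (exists c : seq G, gcycle c /\ size c = g) /\
  (forall c : seq G, gcycle c -> g <= size c).

Lemma gpath_le_detour_order (G : sgraph) (s : seq G) :
  gpath s -> size s <= detour_order G.
Proof.
move=> sP; have ltsG : size s < #|G|.+1.
  by case/andP: sP => s_uniq _; rewrite ltnS -(card_uniqP s_uniq) max_card.
apply: (leq_bigmax_cond (Ordinal ltsG)).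
by apply/existsP; exists (in_tuple s).
Qed.

Lemma detour_order_attained (G : sgraph) :
  exists s : seq G, gpath s /\ size s = detour_order G.
Proof.
have P0 : [exists t : (ord0 : 'I_#|G|.+1).-tuple G, gpath t].
  by apply/existsP; exists [tuple].
rewrite /detour_order (bigmax_eq_arg ord0) //.
case: arg_maxnP => // n /existsP[t tP] _.
by exists t; rewrite size_tuple.
Qed.

(* Main.v *)
Require Import Defs.
From mathcomp Require Import all_boot.

(** Splitting a vertex [v] of a cubic non-hamiltonian graph into three leaves,
    one on each former edge of [v], gives a graph on [n] vertices without a path
    on [n - 1] vertices: such a path would join two of the leaves through all
    vertices of degree 3, that is, it would close up to a hamiltonian cycle
    through [v].  For the Coxeter graph ([n = 30], girth 7), and for the flower
    snark [J5] split at a vertex of its only 5-cycle ([n = 22], girth 6), every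
    new edge does create a path on [n - 1] vertices, so both are
    detour-saturated.  Disjoint copies of a detour-saturated graph [G] are again
    detour-saturated if every vertex of [G] starts a path on more than half of
    the detour order many vertices, because two such paths in different copies
    can be joined by the new edge; this turns the girth 6 example into an
    infinite family. *)

Set Implicit Arguments.
Unset Strict Implicit.
Unset Printing Implicit Defensive.

(** * Paths and detour orders under maps and new edges *)

Lemma add_edge_mono (G : sgraph) (x y u v : G) :
  adj u v -> @adj (add_edge x y) u v.
Proof. by move=> uv; rewrite /= /add_edge_adj uv. Qed.

Lemma add_edge_new (G : sgraph) (x y : G) : x != y -> @adj (add_edge x y) x y.
Proof. by move=> xy; rewrite /= /add_edge_adj xy eqxx orbT. Qed.

Lemma detour_order_hom (G H : sgraph) (f : G -> H) :
  injective f -> {homo f : u v / adj u v} -> detour_order G <= detour_order H.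
Proof.
move=> f_inj f_hom.
have [s [/andP[s_uniq s_path] <-]] := detour_order_attained G.
rewrite -(size_map f); apply: gpath_le_detour_order.
by rewrite /gpath map_inj_uniq // s_uniq sorted_map; apply: sub_sorted s_path.
Qed.

Lemma take_gpath (G : sgraph) n (s : seq G) : gpath s -> gpath (take n s).
Proof. by case/andP=> us ss; rewrite /gpath take_uniq // take_sorted. Qed.

(** * Disjoint copies of a graph *)

Section Copies.

Variables (k : nat) (G : sgraph).

Definition copies_adj : rel ('I_k * G) :=
  fun u v => (u.1 == v.1) && adj u.2 v.2.

Lemma copies_sym : symmetric copies_adj.
Proof. by move=> u v; rewrite /copies_adj eq_sym adj_sym. Qed.

Lemma copies_irrefl : irreflexive copies_adj.
Proof. by move=> u; rewrite /copies_adj adj_irrefl andbF. Qed.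

Definition copies : sgraph := SGraph copies_sym copies_irrefl.

(** A path never leaves its copy, so it can be recovered from its projection; through the second
    conjunct, duplicate-freeness passes to the projection. *)
Lemma copies_path u p : path copies_adj u p ->
  path (@adj G) u.2 (map snd p) /\ u :: p = [seq (u.1, x) | x <- map snd (u :: p)].
Proof.
elim: p u => [|v p IHp] [i x] //= /andP[/andP[/= /eqP iv xv] /IHp[-> ->]].
by rewrite xv -iv /= -map_comp.
Qed.

Lemma copies_gpath (s : seq copies) : gpath s -> gpath (map snd s).
Proof.
case: s => // u p /andP[us /copies_path[sp eqs]].
by apply/andP; split=> //; move: us; rewrite {1}eqs => /map_uniq.
Qed.

Lemma detour_order_copies : detour_order copies <= detour_order G.
Proof.
have [s [sP <-]] := detour_order_attained copies.
by rewrite -(size_map snd); apply/gpath_le_detour_order/copies_gpath.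
Qed.

Lemma detour_saturated_copies :
    detour_saturated G ->
    (forall x : G, exists p, gpath (x :: p) /\ detour_order G < (size p).+1.*2) ->
  detour_saturated copies.
Proof.
(* If the claim failed, the detour order of the enlarged graph would be at most that of [G]. *)
move=> satG startG [i x] [j y] xy nadj; rewrite ltnNge; apply/negP => le_sat.
have le_G := leq_trans le_sat detour_order_copies.
have [eq_ij|neq_ij] := eqVneq i j.
  have neq_xy : x != y by move: xy; rewrite eq_ij xpair_eqE eqxx.
  have nadj_xy : ~~ adj x y by move: nadj; rewrite /= /copies_adj eq_ij eqxx.
  (* Both ends lie in one copy, into which [G] with the edge [xy] embeds; saturation of [G] is then
     contradicted. *)
  suff le_H : detour_order (add_edge x y) <=
              detour_order (add_edge ((i, x) : copies) (j, y)).
    have := leq_trans (satG x y neq_xy nadj_xy) (leq_trans le_H le_G).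
    by rewrite ltnn.
  apply: (@detour_order_hom (add_edge x y) (add_edge ((i, x) : copies) (j, y))
            (fun z : G => (i, z))).
    by move=> u v [].
  move=> u v /orP[uv|/andP[uv /eqP eqS]].
    by apply: add_edge_mono; rewrite /= /copies_adj eqxx.
  apply/orP; right; rewrite xpair_eqE eqxx uv /= -eq_ij.
  by rewrite -!imset_set1 -!imsetU -eqS.
have [p [/andP[up sp] lt_p]] := startG x.
have [q [/andP[uq sq] lt_q]] := startG y.
set H := add_edge _ _ in le_sat le_G *.
have lift_sorted a s :
    sorted (@adj G) s -> sorted (@adj H) [seq (a, z) | z <- s].
  rewrite sorted_map; apply: sub_sorted => u v uv; apply: add_edge_mono.
  by rewrite /= /copies_adj eqxx.
(* The path from [x] is reversed so that it ends at [(i, x)], where the new edge leads on to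
   [(j, y)]. *)
have: gpath (rev [seq (i, z) | z <- x :: p] ++ [seq (j, z) | z <- y :: q] : seq H).
  apply/andP; split.
    have inj a : injective (fun z : G => (a, z) : H) by move=> u v [].
    rewrite cat_uniq rev_uniq !(map_inj_uniq (inj _)) up uq andbT.
    apply/hasPn => _ /mapP[z _ ->].
    by rewrite mem_rev; apply: contraNN neq_ij => /mapP[z' _ [->]].
  rewrite map_cons rev_cons cat_rcons sorted_cat_cons -rev_cons rev_sorted.
  apply/andP; split.
    rewrite (eq_sorted (e' := @adj H)) ?(lift_sorted i (x :: p)) // => u v.
    by rewrite adj_sym.
  by apply/andP; split; [apply: add_edge_new | apply: (lift_sorted j (y :: q))].
move/gpath_le_detour_order; rewrite size_cat size_rev !size_map /= => le_pq.
have := leq_add lt_p lt_q; rewrite -doubleD addnn leq_double.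
by move/leq_trans/(_ (leq_trans le_pq le_G)); rewrite ltnn.
Qed.

Lemma has_girth_copies g : 0 < k -> has_girth G g -> has_girth copies g.
Proof.
move=> k_gt0 [[c [[c_gt2 /andP[c_cyc c_uniq]] <-]] min_g]; split.
  exists [seq (Ordinal k_gt0, x) | x <- c]; split; last by rewrite size_map.
  split; first by rewrite size_map.
  rewrite /ucycle cycle_map map_inj_uniq ?c_uniq; last by move=> x y [].
  rewrite andbT; apply: sub_cycle c_cyc => x y xy.
  by rewrite /= /copies_adj eqxx.
case=> [|u p] [// c_gt2' /andP[c_cyc' c_uniq']].
have [pP _] := copies_path c_cyc'.
rewrite -(size_map snd); apply: min_g; split; first by rewrite size_map.
apply/andP; split; first by rewrite /= -map_rcons.
(* The closed walk gave the adjacencies; duplicate-freeness concerns the open path, without the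
   return to [u]. *)
have /copies_path[_ eq_q] : path copies_adj u p.
  by move: c_cyc'; rewrite /= rcons_path => /andP[].
by move: c_uniq'; rewrite {1}eq_q => /map_uniq.
Qed.

Lemma card_copies : #|copies| = k * #|G|.
Proof. by rewrite card_prod card_ord. Qed.

End Copies.

Lemma gisom_card (G H : sgraph) : gisom G H -> #|G| = #|H|.
Proof. by case=> f [/bij_eq_card]. Qed.


(** * Graphs given by adjacency lists *)

Section ListGraph.

Variable A : seq (seq nat).

(** The default [[::]] leaves indices beyond the end of [A] without neighbours. *)
Definition ladj : rel nat := fun i j => j \in nth [::] A i.

Definition wf_adjacency : bool :=
  all (fun i => (i \notin nth [::] A i) &&
                all (fun j => (j < size A) && ladj j i) (nth [::] A i))
      (iota 0 (size A)).

Hypothesis wfA : wf_adjacency.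

Lemma ladj_lt i j : ladj i j -> i < size A.
Proof. by rewrite /ladj; case: ltnP => // /(nth_default [::])->. Qed.

Lemma ladj_sym : symmetric ladj.
Proof.
suff imp i j : ladj i j -> ladj j i by move=> i j; apply/idP/idP; apply: imp.
move=> ij.
have /(allP wfA)/andP[_ /allP/(_ j ij)/andP[_ //]]: i \in iota 0 (size A).
by rewrite mem_iota (ladj_lt ij).
Qed.

Lemma ladj_irrefl : irreflexive ladj.
Proof.
move=> i; apply/negP => ii.
have /(allP wfA)/andP[/negP[//]]: i \in iota 0 (size A).
by rewrite mem_iota (ladj_lt ii).
Qed.

Definition list_graph : sgraph :=
  @SGraph 'I_(size A) (relpre val ladj)
    (fun x y => ladj_sym (val x) (val y)) (fun x => ladj_irrefl (val x)).

(** Lifts lists of numbers, on which the checks compute, to lists of vertices. *)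
Lemma ord_seq_surj n (s : seq nat) :
  all (fun i => i < n) s -> exists t : seq 'I_n, map val t = s.
Proof.
elim: s => [|i s IHs] /=; first by exists [::].
by case/andP=> lt_i /IHs[t <-]; exists (Ordinal lt_i :: t).
Qed.

(** * Upper bounds on the detour order by exhaustive search *)

(* Conditionals instead of [&&]: [andb] is strict under call by value. *)
Fixpoint search (k : nat) (F : seq nat) (h : nat) : bool :=
  if k is k'.+1 then
    if count (fun u => count (mem (h :: F)) (nth [::] A u) <= 1) F + k' <= size F
    then has (fun j => if j \in F then search k' (rem j F) j else false)
             (nth [::] A h)
    else false
  else true.

(** The predecessor and the successor of [u] on the path are distinct neighbours in [h :: F]. This
    justifies the pruning in [search], where [h] is the current end, [F] the free vertices and [k]
    the number of vertices still to be added. *)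
Lemma interior_degree (F q : seq nat) (h l u : nat) :
    path ladj h (rcons q l) -> uniq (h :: rcons q l) ->
    {subset rcons q l <= F} -> u \in q ->
  1 < count (mem (h :: F)) (nth [::] A u).
Proof.
move=> hq uq qF uin; case/splitPr: q / uin hq uq qF => q1 q2.
rewrite rcons_cat rcons_cons.
case E: (rcons q2 l) => [|b q3]; first by case: (q2) E.
rewrite cat_path => /andP[_ /and3P[au ub _]] uq qF.
set a := last h q1 in au *.
have ain : a \in h :: q1 by rewrite mem_last.
(* If they coincided, this vertex would occur both before and after [u]. *)
have neq_ab : a != b.
  apply: contraTneq uq => eq_ab; rewrite -cat_cons cat_uniq.
  apply/negP => /and3P[_ /hasP[]]; exists b; first by rewrite !inE eqxx orbT.
  by rewrite -eq_ab.
rewrite -size_filter -[2]/(size [:: a; b]); apply: uniq_leq_size.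
  by rewrite /= inE neq_ab.
move=> w; rewrite !inE mem_filter => /orP[]/eqP->.
  rewrite -/(ladj u a) ladj_sym au andbT /=; move: ain.
  by rewrite !inE => /orP[->//|ain]; rewrite qF ?orbT // mem_cat ain.
by rewrite -/(ladj u b) ub /= inE qF ?orbT // mem_cat !inE eqxx !orbT.
Qed.

(* A vertex with at most one neighbour in [h :: F] is the end of [p] or off [p],
   so there are at most [1 + (size F - size p)] of them. *)
Lemma search_complete (p F : seq nat) (h : nat) :
    uniq F -> path ladj h p -> uniq (h :: p) -> {subset p <= F} ->
  search (size p) F h.
Proof.
elim: p F h => // x p IHp F h uF hp up pF /=.
case: ifP => [_|/negP[]].
  apply/hasP; case/andP: hp => hx xp; exists x => //.
  rewrite pF ?mem_head //; apply: IHp => //.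
  - exact: rem_uniq.
  - by case/andP: up.
  - move=> y py; rewrite (rem_filter _ uF) mem_filter.
    rewrite pF ?inE ?py ?orbT // andbT /=.
    by apply: contraTneq py => ->; case/and3P: up.
(* The vertices of [x :: p] before the last are interior, hence disjoint from the counted ones, and
   both kinds lie in [F]. *)
rewrite lastI in hp up pF.
rewrite -size_filter -(size_belast x p) -size_cat; apply: uniq_leq_size.
  move: (up); rewrite cons_uniq rcons_uniq cat_uniq filter_uniq //.
  case/and3P=> _ _ ->.
  rewrite andbT /=; apply/hasPn => u uq; rewrite mem_filter negb_and -ltnNge.
  by rewrite (interior_degree hp up pF uq).
move=> u; rewrite mem_cat mem_filter => /orP[/andP[] // | uq].
by rewrite pF // mem_rcons inE uq orbT.
Qed.

(** A longer path could be cut to a start and [m.+1] further vertices, which the search from that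
    start would find. *)
Lemma detour_order_search m :
  all (fun s => ~~ search m.+1 (rem s (iota 0 (size A))) s) (iota 0 (size A)) ->
  detour_order list_graph <= m.+1.
Proof.
move/allP=> none; have [s [sP <-]] := detour_order_attained list_graph.
rewrite leqNgt; apply/negP => lt_m.
have sz : size (take m.+2 s) = m.+2 by rewrite size_takel.
case: (take m.+2 s) sz (take_gpath m.+2 sP) => // h p [sz] /andP[up hp].
have /none/negP[] : val h \in iota 0 (size A) by rewrite mem_iota /=.
rewrite -sz -(size_map val); apply: search_complete.
- by rewrite rem_uniq ?iota_uniq.
- by rewrite path_map.
- by rewrite -map_cons (map_inj_uniq val_inj).
move=> _ /mapP[x px ->]; rewrite rem_filter ?iota_uniq // mem_filter mem_iota /=.
rewrite ltn_ord andbT (inj_eq val_inj).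
by apply: contraTneq px => ->; case/andP: up.
Qed.

(** * Saturation certified by paths with one gap *)

Definition gaps (w : seq nat) : seq (nat * nat) :=
  [seq e <- zip w (behead w) | ~~ ladj e.1 e.2].

Lemma sorted_zip (T : Type) (e : rel T) (s : seq T) :
  sorted e s = all (fun c => e c.1 c.2) (zip s (behead s)).
Proof. by case: s => //= x s; elim: s x => //= y s IHs x; rewrite IHs. Qed.

Definition almost_path (m : nat) (w : seq nat) : bool :=
  [&& uniq w, all (fun i => i < size A) w, size w == m & size (gaps w) <= 1].

Lemma almost_path_detour m w (x y : list_graph) :
    x != y -> almost_path m w ->
    ((val x, val y) \in gaps w) || ((val y, val x) \in gaps w) ->
  m <= detour_order (add_edge x y).
Proof.
move=> xy /and4P[uw /ord_seq_surj[t eq_t] /eqP <- le_gap] xy_gap.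
rewrite -eq_t size_map; apply: gpath_le_detour_order; apply/andP; split.
  by move: uw; rewrite -eq_t (map_inj_uniq val_inj).
suff: sorted (fun i j => [|| ladj i j, (i, j) == (val x, val y)
                          | (i, j) == (val y, val x)]) w.
  rewrite -eq_t sorted_map; apply: sub_sorted => u v /or3P[uv | /eqP[] | /eqP[]].
  - exact: add_edge_mono.
  - by move=> /val_inj-> /val_inj->; apply: add_edge_new.
  - by move=> /val_inj-> /val_inj->; rewrite adj_sym; apply: add_edge_new.
rewrite sorted_zip; apply/allP => -[i j] ij /=.
have [//|/= nij] := boolP (ladj i j).
have : (i, j) \in gaps w by rewrite mem_filter nij.
(* There is at most one gap and it is the pair [xy], so any broken step is the new edge. *)
case: (gaps w) le_gap xy_gap => [|e []] //= _; rewrite !inE => exy /eqP->.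
by rewrite ![e == _]eq_sym.
Qed.

Definition covers_nonedges (m : nat) (W : seq (seq nat)) : bool :=
  all (almost_path m) W &&
  (let gs := flatten (map gaps W) in
   all (fun i => all (fun j => [|| ladj i j, i == j, (i, j) \in gs
                                     | (j, i) \in gs])
                     (iota 0 (size A))) (iota 0 (size A))).

(** Each non-edge is the only gap of some list in [W], so adding it completes a path on [m.+1]
    vertices. *)
Lemma list_graph_saturated m W :
    detour_order list_graph <= m -> covers_nonedges m.+1 W ->
  detour_saturated list_graph.
Proof.
move=> le_m /andP[/allP pathW /allP covW] x y xy nadj.
apply: leq_ltn_trans le_m _.
have lt_iota (z : list_graph) : val z \in iota 0 (size A) by rewrite mem_iota /=.
have /allP/(_ _ (lt_iota y)) := covW _ (lt_iota x).
rewrite (negPf (nadj : ~~ ladj x y)) (inj_eq val_inj) (negPf xy) /=.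
by case/orP=> /flatten_mapP[w /pathW wP gw]; apply: almost_path_detour wP _;
   rewrite ?gw ?orbT.
Qed.

(** * Paths from every vertex, and girth *)

Definition is_lpath (s : seq nat) : bool :=
  [&& uniq s, all (fun i => i < size A) s & sorted ladj s].

Lemma is_lpathP (s : seq nat) :
  is_lpath s -> exists2 t : seq list_graph, gpath t & map val t = s.
Proof.
case/and3P=> us /ord_seq_surj[t eq_t] ss; exists t => //.
move: us ss; rewrite -eq_t (map_inj_uniq val_inj) sorted_map => us ss.
exact/andP.
Qed.

Lemma list_graph_starts m (W : seq (seq nat)) :
    all (fun i => has (fun w => [&& is_lpath w, size w == m
                                  & head (size A) w == i]) W)
        (iota 0 (size A)) ->
  forall x : list_graph, exists p, gpath (x :: p) /\ (size p).+1 = m.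
Proof.
move/allP=> startW x; have /startW/hasP[w _ /and3P[]] : val x \in iota 0 (size A).
  by rewrite mem_iota /=.
case/is_lpathP=> t tP <-; rewrite size_map => /eqP <-.
(* For the empty list, [head] returns the default [size A], which is no vertex. *)
case: t tP => [|z p] tP /=; first by rewrite (gtn_eqF (ltn_ord x)).
by move/eqP/val_inj <-; exists p.
Qed.

(** Depth-first search for a cycle through [s]: [V] holds the visited vertices, [h] is the latest,
    and at most [k] more may be added. The test [2 < size V] rules out going back along a single
    edge. *)
Fixpoint closes (k s : nat) (V : seq nat) (h : nat) : bool :=
  if (if 2 < size V then ladj h s else false) then true
  else if k is k'.+1 then
    has (fun j => if j \in V then false else closes k' s (j :: V) j) (nth [::] A h)
  else false.

Lemma closes_complete k s V h p :
    path ladj h p -> uniq p -> ~~ has (mem V) p -> ladj (last h p) s ->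
    2 < size V + size p -> size p <= k ->
  closes k s V h.
Proof.
elim: p k V h => [|x p IHp] k V h.
  by rewrite addn0; case: k => [|k] /= _ _ _ -> ->.
case: k => // k /= /andP[hx xp] /andP[xNp up]; rewrite negb_or => /andP[xNV pNV].
move=> ls ltV lek; case: ifP => // _; apply/hasP; exists x => //.
rewrite [x \in V](negPf xNV); apply: IHp => //; last by rewrite addSnnS.
apply/hasPn => y py; rewrite inE negb_or (hasPn pNV _ py) andbT.
by apply: contraNneq xNp => <-.
Qed.

(** A cycle shorter than [g] has at most [g - 2] vertices besides its start, hence the search
    depth. *)
Lemma list_graph_girth g (c : seq nat) :
    is_lpath c -> ladj (last 0 c) (head 0 c) -> size c = g -> 2 < g ->
    all (fun s => ~~ closes (g - 2) s [:: s] s) (iota 0 (size A)) ->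
  has_girth list_graph g.
Proof.
move=> /is_lpathP[t tP <-]; rewrite size_map => cyc <- t_gt2 /allP none; split.
  exists t; split=> //; split=> //; case/andP: tP => ut; rewrite /ucycle ut andbT.
  case: t cyc {t_gt2 none ut} => //= x t; rewrite last_map => cyc xt.
  by rewrite rcons_path xt.
case=> [|x p] [// c_gt2 /andP[/=]]; rewrite rcons_path => /andP[xp px] up.
rewrite leqNgt; apply/negP => lt_c.
have /none/negP[] : val x \in iota 0 (size A) by rewrite mem_iota /=.
apply: (@closes_complete _ _ _ _ (map val p)).
- by rewrite path_map.
- by rewrite (map_inj_uniq val_inj); case/andP: up.
- apply/hasPn => _ /mapP[y py ->]; rewrite /= inE (inj_eq val_inj).
  by apply: contraTneq py => ->; case/andP: up.
- by rewrite last_map.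
- by rewrite size_map.
- by rewrite size_map leq_subRL // (leq_trans _ t_gt2).
Qed.

Lemma card_list_graph : #|list_graph| = size A.
Proof. exact: card_ord. Qed.

End ListGraph.

(** * The two split graphs and their certificates *)

(* The flower snark [J5] has vertices [4 i], ..., [4 i + 3] for [i < 5], with [4 i]
   the centre of the [i]-th star and [4 i + 1] on the 5-cycle.  Vertex [1] is
   removed, the later ones are shifted by one, and [19], [20], [21] are the
   leaves. *)
Definition split_flower : seq (seq nat) :=
  [:: [:: 1; 2; 19]; [:: 0; 5; 18]; [:: 0; 6; 17]; [:: 4; 5; 6]; [:: 3; 8; 20];
      [:: 1; 3; 9]; [:: 2; 3; 10]; [:: 8; 9; 10]; [:: 4; 7; 12]; [:: 5; 7; 13];
      [:: 6; 7; 14]; [:: 12; 13; 14]; [:: 8; 11; 16]; [:: 9; 11; 17]; [:: 10;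
      11; 18]; [:: 16; 17; 18]; [:: 12; 15; 21]; [:: 2; 13; 15]; [:: 1; 14;
      15]; [:: 0]; [:: 4]; [:: 16]].

Definition flower_automorphisms : seq (seq nat) :=
  [:: [:: 0; 1; 2; 3; 4; 5; 6; 7; 8; 9; 10; 11; 12; 13; 14; 15; 16; 17; 18; 19;
      20; 21]; [:: 0; 1; 2; 15; 16; 18; 17; 11; 12; 14; 13; 7; 8; 10; 9; 3; 4;
      6; 5; 19; 21; 20]; [:: 0; 2; 1; 3; 4; 6; 5; 7; 8; 10; 9; 11; 12; 14; 13;
      15; 16; 18; 17; 19; 20; 21]; [:: 0; 2; 1; 15; 16; 17; 18; 11; 12; 13; 14;
      7; 8; 9; 10; 3; 4; 5; 6; 19; 21; 20]].

(* For one non-edge [xy] in each orbit of the automorphism group, a path on 21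
   vertices through [x] and [y] that is broken only between [x] and [y]; below,
   [coxeter_detours] has the same meaning, with 29 vertices. *)
Definition flower_detours : seq (seq nat) :=
  [:: [:: 21; 16; 15; 18; 14; 10; 6; 2; 17; 13; 11; 12; 8; 7; 9; 5; 1; 0; 3; 4;
      20]; [:: 21; 16; 15; 17; 2; 6; 3; 5; 9; 13; 11; 12; 8; 7; 10; 14; 18; 1;
      0; 4; 20]; [:: 20; 4; 8; 12; 11; 13; 9; 7; 10; 14; 18; 1; 0; 5; 3; 6; 2;
      17; 15; 16; 21]; [:: 21; 16; 15; 17; 2; 6; 10; 14; 18; 1; 0; 7; 8; 12;
      11; 13; 9; 5; 3; 4; 20]; [:: 21; 16; 12; 11; 13; 9; 7; 10; 14; 18; 15;
      17; 2; 6; 3; 5; 1; 0; 8; 4; 20]; [:: 20; 4; 3; 5; 1; 0; 9; 7; 8; 12; 11;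
      13; 17; 2; 6; 10; 14; 18; 15; 16; 21]; [:: 21; 16; 15; 18; 14; 10; 7; 9;
      13; 17; 2; 6; 3; 5; 1; 0; 20; 4; 8; 12; 11]; [:: 19; 0; 1; 2; 6; 10; 7;
      8; 4; 3; 5; 9; 13; 17; 15; 18; 14; 11; 12; 16; 21]; [:: 20; 4; 8; 7; 10;
      6; 2; 0; 1; 3; 5; 9; 13; 17; 15; 18; 14; 11; 12; 16; 21]; [:: 21; 16; 15;
      18; 14; 11; 12; 8; 7; 10; 6; 3; 5; 9; 13; 17; 2; 0; 1; 4; 20]; [:: 20; 4;
      3; 5; 9; 13; 17; 2; 0; 1; 6; 10; 7; 8; 12; 11; 14; 18; 15; 16; 21]; [::
      20; 4; 8; 12; 11; 13; 17; 2; 0; 1; 7; 9; 5; 3; 6; 10; 14; 18; 15; 16;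
      21]; [:: 21; 16; 12; 11; 13; 17; 15; 18; 14; 10; 7; 9; 5; 3; 6; 2; 0; 1;
      8; 4; 20]; [:: 19; 0; 1; 9; 5; 3; 6; 2; 17; 13; 11; 12; 16; 15; 18; 14;
      10; 7; 8; 4; 20]; [:: 20; 4; 8; 7; 9; 5; 3; 6; 2; 0; 1; 10; 14; 18; 15;
      17; 13; 11; 12; 16; 21]; [:: 21; 16; 12; 11; 14; 18; 15; 17; 13; 9; 5; 3;
      4; 8; 7; 10; 6; 2; 0; 1; 19]; [:: 18; 15; 17; 13; 11; 14; 10; 7; 9; 5; 3;
      6; 2; 0; 1; 20; 4; 8; 12; 16; 21]; [:: 21; 16; 15; 18; 14; 10; 6; 2; 17;
      13; 11; 12; 8; 4; 3; 7; 9; 5; 1; 0; 19]; [:: 20; 4; 3; 8; 7; 9; 5; 1; 0;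
      2; 6; 10; 14; 18; 15; 17; 13; 11; 12; 16; 21]; [:: 20; 4; 3; 9; 5; 1; 18;
      14; 11; 13; 17; 15; 16; 12; 8; 7; 10; 6; 2; 0; 19]; [:: 20; 4; 3; 11; 13;
      17; 2; 6; 10; 14; 18; 15; 16; 12; 8; 7; 9; 5; 1; 0; 19]; [:: 19; 0; 1; 5;
      9; 7; 8; 4; 3; 12; 11; 13; 17; 2; 6; 10; 14; 18; 15; 16; 21]; [:: 21; 16;
      12; 11; 14; 18; 15; 17; 2; 6; 10; 7; 8; 4; 3; 13; 9; 5; 1; 0; 19]; [::
      19; 0; 1; 5; 9; 7; 8; 4; 3; 15; 18; 14; 10; 6; 2; 17; 13; 11; 12; 16;
      21]; [:: 20; 4; 3; 16; 12; 8; 7; 9; 5; 1; 18; 15; 17; 13; 11; 14; 10; 6;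
      2; 0; 19]; [:: 20; 4; 3; 17; 2; 6; 10; 7; 8; 12; 16; 15; 18; 14; 11; 13;
      9; 5; 1; 0; 19]; [:: 21; 16; 12; 11; 13; 17; 15; 18; 14; 10; 6; 2; 0; 1;
      5; 9; 7; 8; 4; 3; 19]; [:: 21; 16; 12; 11; 13; 17; 15; 18; 14; 10; 6; 2;
      0; 1; 5; 9; 7; 8; 4; 3; 20]; [:: 19; 0; 1; 5; 9; 7; 8; 4; 3; 21; 16; 12;
      11; 13; 17; 2; 6; 10; 14; 18; 15]; [:: 21; 16; 15; 17; 2; 6; 3; 4; 5; 9;
      13; 11; 12; 8; 7; 10; 14; 18; 1; 0; 19]; [:: 19; 0; 1; 18; 15; 17; 2; 6;
      10; 14; 11; 13; 9; 5; 3; 4; 7; 8; 12; 16; 21]; [:: 19; 0; 1; 5; 3; 4; 9;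
      7; 8; 12; 11; 13; 17; 2; 6; 10; 14; 18; 15; 16; 21]; [:: 19; 0; 1; 5; 3;
      4; 11; 12; 8; 7; 9; 13; 17; 2; 6; 10; 14; 18; 15; 16; 21]; [:: 19; 0; 1;
      18; 14; 11; 13; 9; 5; 3; 4; 12; 8; 7; 10; 6; 2; 17; 15; 16; 21]; [:: 21;
      16; 12; 8; 7; 9; 5; 3; 4; 13; 11; 14; 10; 6; 2; 17; 15; 18; 1; 0; 19];
      [:: 19; 0; 2; 6; 10; 14; 11; 12; 8; 7; 9; 13; 17; 15; 18; 1; 5; 3; 4; 16;
      21]; [:: 21; 16; 15; 18; 1; 5; 3; 4; 17; 13; 9; 7; 8; 12; 11; 14; 10; 6;
      2; 0; 19]; [:: 21; 16; 15; 17; 13; 9; 7; 8; 12; 11; 14; 18; 1; 5; 3; 4;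
      19; 0; 2; 6; 10]; [:: 19; 0; 1; 5; 3; 4; 21; 16; 12; 8; 7; 9; 13; 11; 14;
      10; 6; 2; 17; 15; 18]; [:: 21; 16; 15; 18; 1; 5; 6; 3; 4; 8; 12; 11; 14;
      10; 7; 9; 13; 17; 2; 0; 19]; [:: 19; 0; 2; 17; 15; 18; 1; 5; 7; 9; 13;
      11; 14; 10; 6; 3; 4; 8; 12; 16; 21]; [:: 20; 4; 3; 6; 10; 7; 9; 13; 17;
      2; 0; 1; 5; 8; 12; 11; 14; 18; 15; 16; 21]; [:: 21; 16; 15; 18; 14; 11;
      12; 8; 7; 9; 13; 17; 2; 0; 1; 5; 10; 6; 3; 4; 20]; [:: 20; 4; 3; 6; 10;
      14; 18; 15; 17; 2; 0; 1; 5; 11; 13; 9; 7; 8; 12; 16; 21]; [:: 21; 16; 15;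
      18; 1; 5; 12; 11; 14; 10; 6; 3; 4; 8; 7; 9; 13; 17; 2; 0; 19]; [:: 19; 0;
      2; 17; 15; 18; 1; 5; 13; 9; 7; 8; 4; 3; 6; 10; 14; 11; 12; 16; 21]; [::
      21; 16; 15; 18; 1; 5; 14; 11; 12; 8; 4; 3; 6; 10; 7; 9; 13; 17; 2; 0;
      19]; [:: 19; 0; 1; 5; 17; 2; 6; 3; 4; 8; 12; 11; 13; 9; 7; 10; 14; 18;
      15; 16; 21]; [:: 20; 4; 3; 6; 10; 14; 11; 12; 8; 7; 9; 13; 17; 2; 0; 1;
      5; 18; 15; 16; 21]; [:: 21; 16; 15; 18; 14; 11; 12; 8; 4; 3; 6; 10; 7; 9;
      13; 17; 2; 0; 1; 5; 19]; [:: 21; 16; 15; 18; 14; 11; 12; 8; 7; 9; 13; 17;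
      2; 0; 1; 5; 20; 4; 3; 6; 10]; [:: 20; 4; 3; 6; 10; 14; 11; 12; 8; 7; 9;
      13; 17; 2; 0; 1; 5; 21; 16; 15; 18]; [:: 19; 0; 2; 17; 15; 16; 12; 8; 7;
      11; 13; 9; 5; 1; 18; 14; 10; 6; 3; 4; 20]; [:: 19; 0; 1; 18; 15; 17; 2;
      6; 10; 14; 11; 13; 9; 5; 3; 4; 8; 7; 12; 16; 21]; [:: 21; 16; 12; 11; 14;
      10; 6; 3; 4; 8; 7; 13; 9; 5; 1; 18; 15; 17; 2; 0; 19]; [:: 9; 13; 17; 15;
      18; 1; 5; 3; 4; 8; 7; 19; 0; 2; 6; 10; 14; 11; 12; 16; 21]; [:: 19; 0; 1;
      18; 14; 10; 6; 2; 17; 15; 16; 12; 11; 13; 9; 5; 3; 4; 8; 7; 20]; [:: 9;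
      13; 17; 15; 18; 1; 5; 3; 4; 8; 7; 21; 16; 12; 11; 14; 10; 6; 2; 0; 19];
      [:: 20; 4; 8; 9; 7; 10; 14; 18; 15; 16; 12; 11; 13; 17; 2; 6; 3; 5; 1; 0;
      19]; [:: 19; 0; 1; 5; 3; 4; 8; 13; 9; 7; 10; 6; 2; 17; 15; 18; 14; 11;
      12; 16; 21]; [:: 21; 16; 12; 11; 14; 18; 15; 17; 13; 9; 7; 10; 6; 2; 0;
      1; 5; 3; 4; 8; 19]; [:: 21; 16; 12; 11; 14; 18; 15; 17; 13; 9; 7; 10; 6;
      2; 0; 1; 5; 3; 4; 8; 20]; [:: 19; 0; 1; 5; 3; 4; 8; 21; 16; 12; 11; 13;
      9; 7; 10; 6; 2; 17; 15; 18; 14]; [:: 19; 0; 1; 5; 9; 10; 7; 8; 12; 16;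
      15; 18; 14; 11; 13; 17; 2; 6; 3; 4; 20]; [:: 20; 4; 3; 6; 10; 7; 8; 12;
      11; 13; 17; 2; 0; 1; 5; 9; 14; 18; 15; 16; 21]; [:: 21; 16; 12; 11; 13;
      17; 15; 18; 14; 10; 7; 8; 4; 3; 6; 2; 0; 1; 5; 9; 19]; [:: 21; 16; 12;
      11; 13; 17; 15; 18; 14; 10; 7; 8; 4; 3; 6; 2; 0; 1; 5; 9; 20]; [:: 20; 4;
      3; 6; 2; 0; 1; 5; 9; 21; 16; 12; 8; 7; 10; 14; 11; 13; 17; 15; 18]; [::
      18; 14; 10; 6; 2; 17; 15; 16; 12; 11; 13; 9; 7; 8; 4; 3; 5; 1; 0; 19;
      20]; [:: 9; 13; 17; 15; 18; 14; 11; 12; 8; 7; 10; 6; 2; 0; 1; 5; 3; 4;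
      20; 21; 16]].

(* The vertices of the Coxeter graph are the 28 non-collinear triples of points of
   the Fano plane, in lexicographic order, disjoint triples being adjacent.  The
   last one is removed, and [27], [28], [29] are the leaves. *)
Definition split_coxeter : seq (seq nat) :=
  [:: [:: 25; 26; 27]; [:: 21; 24; 26]; [:: 20; 21; 23]; [:: 20; 22; 25]; [::
      18; 19; 28]; [:: 16; 17; 26]; [:: 15; 17; 19]; [:: 13; 14; 24]; [:: 14;
      19; 23]; [:: 13; 18; 22]; [:: 12; 13; 16]; [:: 12; 15; 20]; [:: 10; 11;
      29]; [:: 7; 9; 10]; [:: 7; 8; 25]; [:: 6; 11; 24]; [:: 5; 10; 23]; [:: 5;
      6; 22]; [:: 4; 9; 21]; [:: 4; 6; 8]; [:: 2; 3; 11]; [:: 1; 2; 18]; [:: 3;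
      9; 17]; [:: 2; 8; 16]; [:: 1; 7; 15]; [:: 0; 3; 14]; [:: 0; 1; 5]; [::
      0]; [:: 4]; [:: 12]].

(** The Coxeter graph is vertex-transitive with 336 automorphisms, so 336 / 28 = 12 of them fix the
    removed vertex. Each is stored as its list of images. *)
Definition coxeter_automorphisms : seq (seq nat) :=
  [:: [:: 0; 1; 2; 3; 4; 5; 6; 7; 8; 9; 10; 11; 12; 13; 14; 15; 16; 17; 18; 19;
      20; 21; 22; 23; 24; 25; 26; 27; 28; 29]; [:: 0; 3; 2; 1; 12; 14; 13; 17;
      16; 15; 19; 18; 4; 6; 5; 9; 8; 7; 11; 10; 21; 20; 24; 23; 22; 26; 25; 27;
      29; 28]; [:: 0; 5; 23; 14; 12; 1; 15; 22; 20; 13; 18; 19; 4; 9; 3; 6; 21;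
      24; 10; 11; 8; 16; 7; 2; 17; 25; 26; 27; 29; 28]; [:: 0; 14; 23; 5; 4; 3;
      9; 24; 21; 6; 11; 10; 12; 15; 1; 13; 20; 22; 19; 18; 16; 8; 17; 2; 7; 26;
      25; 27; 28; 29]; [:: 4; 6; 24; 21; 12; 8; 16; 22; 13; 20; 25; 26; 0; 3;
      9; 5; 14; 23; 11; 10; 1; 15; 2; 7; 17; 18; 19; 28; 29; 27]; [:: 4; 8; 7;
      9; 0; 6; 5; 2; 1; 3; 11; 10; 12; 20; 21; 16; 15; 17; 25; 26; 13; 14; 22;
      24; 23; 18; 19; 28; 27; 29]; [:: 4; 9; 7; 8; 12; 21; 20; 17; 15; 16; 26;
      25; 0; 5; 6; 3; 1; 2; 10; 11; 14; 13; 23; 24; 22; 19; 18; 28; 29; 27];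
      [:: 4; 21; 24; 6; 0; 9; 3; 23; 14; 5; 10; 11; 12; 16; 8; 20; 13; 22; 26;
      25; 15; 1; 17; 7; 2; 19; 18; 28; 27; 29]; [:: 12; 13; 22; 20; 4; 16; 8;
      24; 6; 21; 26; 25; 0; 1; 15; 14; 5; 23; 18; 19; 3; 9; 2; 17; 7; 11; 10;
      29; 28; 27]; [:: 12; 15; 17; 16; 4; 20; 21; 7; 9; 8; 25; 26; 0; 14; 13;
      1; 3; 2; 19; 18; 5; 6; 23; 22; 24; 10; 11; 29; 28; 27]; [:: 12; 16; 17;
      15; 0; 13; 14; 2; 3; 1; 18; 19; 4; 21; 20; 8; 9; 7; 26; 25; 6; 5; 24; 22;
      23; 11; 10; 29; 27; 28]; [:: 12; 20; 22; 13; 0; 15; 1; 23; 5; 14; 19; 18;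
      4; 8; 16; 21; 6; 24; 25; 26; 9; 3; 7; 17; 2; 10; 11; 29; 27; 28]].

Definition coxeter_detours : seq (seq nat) :=
  [:: [:: 29; 12; 10; 13; 9; 22; 17; 6; 19; 8; 14; 7; 24; 15; 11; 20; 3; 25; 0;
      1; 26; 5; 16; 23; 2; 21; 18; 4; 28]; [:: 29; 12; 10; 13; 7; 14; 8; 23;
      16; 5; 26; 1; 24; 15; 11; 20; 3; 25; 0; 2; 21; 18; 9; 22; 17; 6; 19; 4;
      28]; [:: 29; 12; 10; 13; 7; 14; 8; 19; 6; 17; 22; 9; 18; 21; 2; 23; 16;
      5; 26; 1; 24; 15; 11; 20; 3; 25; 0; 4; 28]; [:: 28; 4; 18; 21; 1; 26; 5;
      17; 22; 9; 13; 10; 16; 23; 2; 20; 3; 25; 0; 6; 19; 8; 14; 7; 24; 15; 11;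
      12; 29]; [:: 29; 12; 11; 20; 3; 25; 0; 7; 14; 8; 19; 6; 15; 24; 1; 26; 5;
      17; 22; 9; 13; 10; 16; 23; 2; 21; 18; 4; 28]; [:: 29; 12; 11; 20; 3; 25;
      0; 8; 14; 7; 13; 10; 16; 23; 2; 21; 18; 9; 22; 17; 5; 26; 1; 24; 15; 6;
      19; 4; 28]; [:: 28; 4; 19; 6; 17; 22; 9; 18; 21; 2; 20; 3; 25; 0; 10; 13;
      7; 14; 8; 23; 16; 5; 26; 1; 24; 15; 11; 12; 29]; [:: 22; 17; 5; 26; 1;
      24; 7; 14; 8; 23; 16; 10; 13; 9; 18; 21; 2; 20; 3; 25; 0; 28; 4; 19; 6;
      15; 11; 12; 29]; [:: 27; 0; 26; 5; 17; 6; 19; 4; 18; 21; 1; 2; 20; 11;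
      15; 24; 7; 13; 9; 22; 3; 25; 14; 8; 23; 16; 10; 12; 29]; [:: 29; 12; 11;
      20; 2; 21; 1; 3; 22; 17; 5; 26; 0; 25; 14; 7; 24; 15; 6; 19; 8; 23; 16;
      10; 13; 9; 18; 4; 28]; [:: 28; 4; 18; 9; 13; 10; 16; 23; 8; 19; 6; 17;
      22; 3; 20; 2; 21; 1; 5; 26; 0; 25; 14; 7; 24; 15; 11; 12; 29]; [:: 29;
      12; 11; 15; 24; 7; 14; 25; 0; 26; 5; 17; 22; 3; 20; 2; 21; 1; 6; 19; 8;
      23; 16; 10; 13; 9; 18; 4; 28]; [:: 29; 12; 11; 20; 2; 21; 1; 7; 24; 15;
      6; 19; 4; 18; 9; 13; 10; 16; 23; 8; 14; 25; 3; 22; 17; 5; 26; 0; 27]; [::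
      29; 12; 11; 20; 2; 21; 1; 8; 23; 16; 10; 13; 9; 18; 4; 19; 6; 15; 24; 7;
      14; 25; 3; 22; 17; 5; 26; 0; 27]; [:: 29; 12; 11; 20; 2; 21; 1; 9; 18; 4;
      19; 6; 15; 24; 7; 13; 10; 16; 23; 8; 14; 25; 3; 22; 17; 5; 26; 0; 27];
      [:: 29; 12; 11; 15; 24; 7; 14; 25; 0; 26; 5; 16; 23; 8; 19; 6; 17; 22; 3;
      20; 2; 21; 1; 10; 13; 9; 18; 4; 28]; [:: 28; 4; 18; 9; 13; 10; 16; 23; 8;
      19; 6; 15; 24; 7; 14; 25; 0; 26; 5; 17; 22; 3; 20; 2; 21; 1; 11; 12; 29];
      [:: 28; 4; 18; 9; 22; 3; 20; 2; 21; 1; 13; 10; 16; 23; 8; 19; 6; 17; 5;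
      26; 0; 25; 14; 7; 24; 15; 11; 12; 29]; [:: 28; 4; 18; 9; 22; 3; 20; 2;
      21; 1; 14; 25; 0; 26; 5; 17; 6; 19; 8; 23; 16; 10; 13; 7; 24; 15; 11; 12;
      29]; [:: 28; 4; 18; 9; 13; 10; 12; 11; 20; 2; 21; 1; 15; 24; 7; 14; 25;
      3; 22; 17; 6; 19; 8; 23; 16; 5; 26; 0; 27]; [:: 28; 4; 18; 9; 13; 10; 12;
      11; 20; 2; 21; 1; 17; 22; 3; 25; 14; 7; 24; 15; 6; 19; 8; 23; 16; 5; 26;
      0; 27]; [:: 29; 12; 11; 15; 24; 7; 14; 25; 0; 26; 5; 17; 6; 19; 8; 23;
      16; 10; 13; 9; 22; 3; 20; 2; 21; 1; 18; 4; 28]; [:: 28; 4; 18; 9; 22; 3;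
      20; 2; 21; 1; 19; 6; 17; 5; 26; 0; 25; 14; 8; 23; 16; 10; 13; 7; 24; 15;
      11; 12; 29]; [:: 28; 4; 18; 9; 13; 10; 12; 11; 15; 24; 7; 14; 25; 3; 20;
      2; 21; 1; 22; 17; 6; 19; 8; 23; 16; 5; 26; 0; 27]; [:: 28; 4; 18; 21; 1;
      23; 2; 20; 3; 25; 0; 26; 5; 16; 10; 13; 9; 22; 17; 6; 19; 8; 14; 7; 24;
      15; 11; 12; 29]; [:: 27; 0; 26; 5; 17; 6; 19; 4; 18; 9; 22; 3; 20; 2; 21;
      1; 25; 14; 8; 23; 16; 10; 13; 7; 24; 15; 11; 12; 29]; [:: 29; 12; 11; 15;
      24; 7; 13; 10; 16; 23; 8; 14; 25; 0; 26; 5; 17; 6; 19; 4; 18; 9; 22; 3;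
      20; 2; 21; 1; 27]; [:: 29; 12; 11; 15; 24; 7; 14; 25; 0; 26; 5; 17; 6;
      19; 8; 23; 16; 10; 13; 9; 22; 3; 20; 2; 21; 1; 28; 4; 18]; [:: 27; 0; 26;
      5; 17; 6; 19; 4; 18; 9; 22; 3; 20; 2; 21; 1; 29; 12; 11; 15; 24; 7; 13;
      10; 16; 23; 8; 14; 25]; [:: 29; 12; 11; 15; 24; 1; 21; 18; 9; 22; 3; 20;
      2; 7; 13; 10; 16; 23; 8; 14; 25; 0; 26; 5; 17; 6; 19; 4; 28]; [:: 28; 4;
      19; 6; 17; 5; 16; 23; 8; 14; 25; 0; 26; 1; 21; 18; 9; 22; 3; 20; 2; 10;
      13; 7; 24; 15; 11; 12; 29]; [:: 29; 12; 10; 16; 23; 8; 19; 6; 17; 5; 26;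
      0; 25; 14; 7; 13; 9; 22; 3; 20; 2; 11; 15; 24; 1; 21; 18; 4; 28]; [:: 27;
      0; 26; 1; 21; 18; 9; 13; 10; 12; 11; 20; 2; 22; 3; 25; 14; 7; 24; 15; 6;
      17; 5; 16; 23; 8; 19; 4; 28]; [:: 27; 0; 26; 1; 21; 18; 9; 13; 10; 12;
      11; 20; 2; 25; 3; 22; 17; 5; 16; 23; 8; 14; 7; 24; 15; 6; 19; 4; 28]; [::
      28; 4; 18; 21; 1; 24; 15; 11; 12; 10; 16; 23; 8; 19; 6; 17; 5; 26; 0; 25;
      14; 7; 13; 9; 22; 3; 20; 2; 27]; [:: 29; 12; 10; 16; 23; 8; 19; 6; 17; 5;
      26; 0; 25; 14; 7; 13; 9; 22; 3; 20; 2; 28; 4; 18; 21; 1; 24; 15; 11]; [::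
      29; 12; 10; 11; 15; 6; 17; 22; 9; 13; 7; 24; 1; 21; 18; 4; 19; 8; 14; 25;
      3; 20; 2; 23; 16; 5; 26; 0; 27]; [:: 28; 4; 19; 6; 15; 11; 12; 10; 18;
      21; 2; 20; 3; 25; 14; 8; 23; 16; 5; 17; 22; 9; 13; 7; 24; 1; 26; 0; 27];
      [:: 27; 0; 25; 14; 8; 23; 16; 5; 26; 1; 24; 7; 13; 9; 18; 21; 2; 20; 3;
      22; 17; 6; 15; 11; 12; 10; 19; 4; 28]; [:: 28; 4; 19; 8; 23; 16; 5; 26;
      1; 24; 7; 13; 9; 18; 21; 2; 20; 3; 22; 17; 6; 15; 11; 12; 10; 27; 0; 25;
      14]; [:: 27; 0; 26; 5; 16; 23; 2; 20; 3; 25; 14; 8; 19; 4; 18; 21; 1; 24;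
      7; 13; 9; 22; 17; 6; 15; 11; 12; 10; 29]; [:: 29; 12; 11; 15; 6; 19; 8;
      23; 16; 10; 13; 7; 24; 1; 21; 2; 20; 3; 25; 0; 27; 28; 4; 18; 9; 22; 17;
      5; 26]].

(** * Verification by computation *)

Lemma split_flower_wf : wf_adjacency split_flower.
Proof. by vm_compute. Qed.

Lemma split_coxeter_wf : wf_adjacency split_coxeter.
Proof. by vm_compute. Qed.

(** The bound is two below the order 22: the search excludes paths on all but one of the vertices.
    The bound 28 for order 30 arises likewise. *)
Lemma split_flower_detour_order :
  detour_order (list_graph split_flower_wf) <= 20.
Proof. by apply: detour_order_search; vm_compute. Qed.

Lemma split_coxeter_detour_order :
  detour_order (list_graph split_coxeter_wf) <= 28.
Proof. by apply: detour_order_search; vm_compute. Qed.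

(** Moves the detours of the orbit representatives to all non-edges; [covers_nonedges] then checks
    every resulting list directly. *)
Definition orbit_seqs (S W : seq (seq nat)) : seq (seq nat) :=
  [seq map (nth 0 s) w | s <- S, w <- W].

Lemma split_flower_saturated : detour_saturated (list_graph split_flower_wf).
Proof.
apply: (list_graph_saturated split_flower_detour_order
          (W := orbit_seqs flower_automorphisms flower_detours)).
by vm_compute.
Qed.

Lemma split_coxeter_saturated : detour_saturated (list_graph split_coxeter_wf).
Proof.
apply: (list_graph_saturated split_coxeter_detour_order
          (W := orbit_seqs coxeter_automorphisms coxeter_detours)).
by vm_compute.
Qed.

Lemma split_flower_girth : has_girth (list_graph split_flower_wf) 6.
Proof.
by apply: (@list_graph_girth _ _ _ [:: 0; 2; 6; 3; 5; 1]); vm_compute.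
Qed.

Lemma split_coxeter_girth : has_girth (list_graph split_coxeter_wf) 7.
Proof.
by apply: (@list_graph_girth _ _ _ [:: 0; 25; 3; 22; 17; 5; 26]); vm_compute.
Qed.

(* This cycle passes through all vertices but the three leaves. *)
Definition flower_cycle : seq nat :=
  [:: 0; 1; 5; 9; 7; 8; 4; 3; 6; 10; 14; 18; 15; 16; 12; 11; 13; 17; 2].

Lemma split_flower_starts (x : list_graph split_flower_wf) :
  exists p, gpath (x :: p) /\ (size p).+1 = 19.
Proof.
(* The rotations start at each of the 19 cycle vertices. A leaf is followed by 18 vertices of the
   rotation that starts at its neighbour; the other combinations are no paths and are passed
   over. *)
pose rots := [seq rot i flower_cycle | i <- iota 0 19].
apply: (list_graph_starts
  (W := rots ++ [seq l :: take 18 r | l <- [:: 19; 20; 21], r <- rots])).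
by vm_compute.
Qed.

Theorem theorem4 :
  (exists G : nat -> sgraph,
     (forall i : nat, detour_saturated (G i) /\ has_girth (G i) 6) /\
     (forall i j : nat, i <> j -> ~ gisom (G i) (G j))) /\
  (exists G : sgraph,
     detour_saturated G /\ has_girth G 7 /\ #|G| = 30).
Proof.
split.
  (* With [k.+1] there is at least one copy to contain a 6-cycle; the orders [k.+1 * 22] tell the
     graphs apart. *)
  exists (fun k => copies k.+1 (list_graph split_flower_wf)).
  split=> [k | i j neq_ij /gisom_card].
    split; last exact: has_girth_copies split_flower_girth.
    apply: detour_saturated_copies split_flower_saturated _ => x.
    have [p [xp size_p]] := split_flower_starts x; exists p; rewrite size_p.
    (* This is the estimate [20 < 2 * 19]. *)
    by split=> //; apply: leq_ltn_trans split_flower_detour_order _.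
  rewrite !card_copies card_list_graph => /eqP.
  by rewrite eqn_pmul2r // eqSS => /eqP.
exists (list_graph split_coxeter_wf).
split; first exact: split_coxeter_saturated.
by split; [exact: split_coxeter_girth | rewrite card_list_graph].
Qed.
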